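(* Let $\ell \geq 1$ and suppose $m \geq 3$. No $(\ell^2+1, m, \ell; 1)$-SCEDF in $\mathbb{Z}_{\ell^2+1}$ can contain the set $\{0,1,\dots,\ell-1\}$ or the set $\{\ell, 2\ell, \dots, \ell^2\}$ as one of its $m$ sets.
   Context: For two disjoint subsets $A,B$ of an additive abelian group $G$, $\mathcal{D}(B,A)$ denotes the multiset $\{y-x : y\in B, x\in A\}$. An $(n,m,\ell;\lambda)$-strong circular external difference family, or $(n,m,\ell;\lambda)$-SCEDF, in an additive abelian group $G$ of order $n$ is a family of $m$ pairwise disjoint $\ell$-subsets $A_0,\dots,A_{m-1}$ of $G$ such that, for every $j$ with $0\leq j\leq m-1$, the multiset equation $\mathcal{D}(A_{j+1\bmod m},A_j)=\lambda(G\setminus\{0\})$ holds, i.e. each nonzero element of $G$ occurs exactly $\lambda$ times. *)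

(* Defs.v *)
From mathcomp Require Import all_boot all_order all_algebra.
Set Implicit Arguments.
Unset Strict Implicit.
Unset Printing Implicit Defensive.
Import GRing.Theory.
Local Open Scope ring_scope.

(* The multiset D(B, A), as a sequence considered up to permutation. *)
Definition diffs (G : finZmodType) (B A : {set G}) : seq G :=
  [seq y - x | y <- enum B, x <- enum A].

(* The last clause is the multiset equation D(A_{j+1 mod m}, A_j) =
   lambda (G \ {0}); ordS is the cyclic successor on 'I_m. *)
Definition scedf (G : finZmodType) (n m l lambda : nat)
    (A : 'I_m -> {set G}) : Prop :=
  [/\ #|G| = n,
      forall j, #|A j| = l,
      forall i j, i != j -> [disjoint A i & A j] &
      forall j g, count_mem g (diffs (A (ordS j)) (A j)) =
                  if g == 0 then 0%N else lambda].

(* Main.v *)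
Require Import Defs.
From mathcomp Require Import all_boot all_order all_algebra.
Import GRing.Theory.
Local Open Scope ring_scope.

(** For three consecutive sets C, A, B of a family with constant lambda, both
    h |-> #{a in A | h + a in B} and h |-> #{a in A | h + a in C} equal
    lambda on nonzero elements and 0 at 0, because this function is even. Thus
    f = 1_B - 1_C has vanishing sums over all translates of A. If A is an
    arithmetic progression of length l and difference d, comparing two
    consecutive translates gives f (h + l d) = f h. For d = 1 and for d = l the
    element l d generates Z_(l^2+1), as l^2 = -1 there, so f is constant; this
    is impossible for disjoint nonempty B and C, and these are disjoint as soon
    as m >= 3. *)

Lemma count_diffsl (G : finZmodType) (B A : {set G}) (g : G) :
  count_mem g (diffs B A) = (\sum_(a in A) ((g + a)%R \in B))%N.
Proof.
rewrite -sum1_count big_mkcond big_allpairs_dep exchange_big big_enum /=.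
apply: eq_bigr => a _.
rewrite big_enum -big_mkcondr /= sum1_card.
case: (boolP (g + a \in B)) => hB.
  rewrite -[RHS](card1 (g + a)); apply: eq_card => y.
  rewrite !inE unfold_in /= subr_eq andbC.
  by case: eqP => // ->.
apply: eq_card0 => y; rewrite unfold_in /= subr_eq andbC.
by case: eqP => // ->; rewrite (negbTE hB).
Qed.

Lemma count_diffsC (G : finZmodType) (B A : {set G}) (g : G) :
  count_mem g (diffs B A) = count_mem (- g) (diffs A B).
Proof.
rewrite -!sum1_count big_mkcond big_allpairs_dep exchange_big /=.
rewrite [RHS]big_mkcond big_allpairs_dep /=.
by do 2!apply: eq_bigr => ? _; rewrite -opprB eqr_oppLR.
Qed.

Lemma progression_sum_periodic (G V : zmodType) (f : G -> V) (d : G) (l : nat) :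
  (forall h, \sum_(i < l) f (h + d *+ i) = 0) ->
  forall h k, f (h + d *+ l *+ k) = f h.
Proof.
move=> f0 h k; elim: k => [|k IHk]; first by rewrite mulr0n addr0.
rewrite mulrSr addrA -IHk; move: {IHk}(h + _) => {}h.
have := f0 (h + d); under eq_bigr => i _ do rewrite -addrA -mulrS.
(* Split the sum of [l.+1] consecutive terms at its first term, then at its last. *)
move=> f1; have : \sum_(i < l.+1) f (h + d *+ i) = f h.
  by rewrite big_ord_recl mulr0n addr0 f1 addr0.
by rewrite big_ord_recr /= f0 add0r.
Qed.

Lemma scedf_not_progression (G : finZmodType) (n m l lambda : nat)
    (A : 'I_m -> {set G}) (j : 'I_m) (a d : G) :
  (0 < l)%N -> (2 < m)%N -> scedf n l lambda A ->
  (forall g, exists k, g = d *+ l *+ k) ->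
  A j <> [set a + d *+ i | i : 'I_l].
Proof.
move=> l_gt0 m_gt2 [_ cardA disjA diffA] gen Aj.
(* By cardinality the terms are distinct, so sums over [A j] can be indexed by [i]. *)
have /imset_injP inj_prog : #|[set a + d *+ i | i : 'I_l]| == #|'I_l|.
  by rewrite -Aj cardA card_ord.
pose B := A (ordS j); pose C := A (ord_pred j).
have disjBC : [disjoint B & C].
  (* Equal indices would give [j + 2 = j] modulo [m], impossible as [2 < m]. *)
  apply: disjA; apply/eqP => /(congr1 (@ordS m)); rewrite ord_predK => /val_eqP/=.
  case: j {Aj B C} => j lt_jm /=.
  rewrite -addn1 modnDml addn1 -[X in _ == X](modn_small lt_jm).
  by rewrite -addn2 -[X in _ == X %[mod _]]addn0 eqn_modDl mod0n modn_small.
have cntBC h : count_mem h (diffs B (A j)) = count_mem h (diffs C (A j)).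
  have := diffA (ord_pred j) (- h); rewrite ord_predK -/C.
  by rewrite count_diffsC opprK oppr_eq0 => ->; apply: diffA.
pose f h : int := (h \in B)%:R - (h \in C)%:R.
have f0 h : \sum_(i < l) f (h + d *+ i) = 0.
  (* The shift by [- a] cancels the progression's starting point. *)
  have := cntBC (h - a); rewrite !count_diffsl Aj !big_imset //=.
  under eq_bigr => i _ do rewrite addrA subrK.
  under [RHS]eq_bigr => i _ do rewrite addrA subrK.
  by rewrite sumrB -!natr_sum => ->; rewrite subrr.
have [b bB] : exists b, b \in B by apply/card_gt0P; rewrite cardA.
have [c cC] : exists c, c \in C by apply/card_gt0P; rewrite cardA.
(* A multiple of the period leads from [b] to [c], yet [f] is 1 at [b] and -1 at [c]. *)
have [k] := gen (c - b); move/(canRL (subrK _)); rewrite addrC => c_eq.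
have := progression_sum_periodic _ _ f d l f0 b k; rewrite -c_eq /f bB cC.
by rewrite (disjointFr disjBC bB) (disjointFl disjBC cC).
Qed.

Theorem corollary3p12 (l m : nat) (hl : (1 <= l)%N) (hm : (3 <= m)%N)
    (A : 'I_m -> {set 'Z_(l ^ 2 + 1)}) :
  scedf (l ^ 2 + 1) l 1 A ->
  forall j : 'I_m,
    A j <> [set (i : nat)%:R | i : 'I_l] /\
    A j <> [set (i.+1 * l)%:R | i : 'I_l].
Proof.
move=> scA j.
have n_gt1 : (1 < l ^ 2 + 1)%N by rewrite addn1 ltnS expn_gt0 hl.
have ll : l%:R * l%:R = -1 :> 'Z_(l ^ 2 + 1).
  by apply/eqP; rewrite -addr_eq0 -natrM mulnn -(natrD _ _ 1) pchar_Zp.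
split=> Aj.
- apply: (scedf_not_progression _ _ _ _ _ A j 0 1 hl hm scA).
    (* Here [d *+ l] is [l], with inverse [-l]; the residue is read as its natural
       representative. *)
    move=> g; exists (- (l%:R * g) : 'Z_(l ^ 2 + 1)).
    by rewrite -[RHS]mulr_natr natr_Zp mulrN mulrA ll mulN1r opprK.
  by rewrite Aj; apply: eq_imset => i; rewrite add0r.
apply: (scedf_not_progression _ _ _ _ _ A j l%:R l%:R hl hm scA).
  (* Now [d *+ l] is [l * l = -1]. *)
  move=> g; exists (- g : 'Z_(l ^ 2 + 1)).
  by rewrite -[RHS]mulr_natr natr_Zp -(mulr_natr l%:R l) ll mulN1r opprK.
by rewrite Aj; apply: eq_imset => i; rewrite natrM mulr_natl mulrS.
Qed.
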